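(* Let $q$ be a prime power. If $p\in\mathbb{P}^2(\overline{\mathbb{F}}_q)$ is $q$-generic, then the line $\ell=\langle p,f(p)\rangle$ is $q$-generic.
   Context: $f=\mathrm{Frob}_q$ acts on $\mathbb{P}^2(\overline{\mathbb{F}}_q)$ by raising coordinates to the $q$th power, and correspondingly on lines. A $q$-point (respectively $q$-line) is a point (respectively line) fixed by $f$. A point is $q$-generic if it does not lie on any $q$-line; dually, a line is $q$-generic if it does not contain any $q$-point. For distinct points $p_1,p_2$, $\langle p_1,p_2\rangle$ is the unique line containing both (a $q$-generic point $p$ satisfies $p\ne f(p)$, since every $q$-point lies on a $q$-line). *)

(* Defs.v *)
From HB Require Import structures.
From mathcomp Require Import all_boot all_order all_algebra all_field.

Set Implicit Arguments.
Unset Strict Implicit.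
Unset Printing Implicit Defensive.

Import GRing.Theory.
Local Open Scope ring_scope.

(* P^2(K): the 1-dimensional subspaces of K^3; its lines are the
   2-dimensional subspaces, and incidence is inclusion of subspaces. *)
Section ProjectivePlane.
Variable K : fieldType.

Record point := Point {
  point_sub :> {vspace 'rV[K]_3};
  point_dim : \dim point_sub == 1%N }.
HB.instance Definition _ := [isSub of point for point_sub].
HB.instance Definition _ := [Choice of point by <:].

Record line := Line {
  line_sub :> {vspace 'rV[K]_3};
  line_dim : \dim line_sub == 2%N }.
HB.instance Definition _ := [isSub of line for line_sub].
HB.instance Definition _ := [Choice of line by <:].

Definition on_line (p : point) (l : line) : bool := (p <= l)%VS.

Lemma line_through_subproof (p1 p2 : point) :
  p1 != p2 -> \dim (p1 + p2)%VS == 2%N.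
Proof.
move=> ne; have d1 := eqP (point_dim p1); have d2 := eqP (point_dim p2).
suff I0 : (p1 :&: p2 = 0)%VS.
  by rewrite dimv_disjoint_sum // d1 d2.
apply/eqP; rewrite -dimv_eq0; apply: contraNT ne => cap0.
have capE (U : {vspace 'rV[K]_3}) : \dim U = 1%N ->
  (p1 :&: p2 <= U)%VS -> (p1 :&: p2)%VS = U.
  by move=> dU sU; apply/eqP; rewrite eqEdim sU dU lt0n.
apply/eqP/val_inj.
by rewrite /= -[LHS](capE _ d1 (capvSl _ _)) -[RHS](capE _ d2 (capvSr _ _)).
Qed.

Definition line_through (p1 p2 : point) (ne : p1 != p2) : line :=
  Line (line_through_subproof ne).

Lemma line_throughP (p1 p2 : point) (ne : p1 != p2) (l : line) :
  on_line p1 l && on_line p2 l = (l == line_through ne).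
Proof.
rewrite /on_line -subv_add -val_eqE /= eq_sym eqEdim.
by rewrite (eqP (line_dim l)) (eqP (line_through_subproof ne)) leqnn andbT.
Qed.

End ProjectivePlane.

Section Frobenius.
Variables (K : fieldType) (q : nat).

Definition frobv (v : 'rV[K]_3) : 'rV[K]_3 := map_mx (fun x => x ^+ q) v.

(* When q is a power of the characteristic and K is algebraically closed, this
   is the image of U under frobv, for any choice of basis (frob_subP); in
   particular <[v]> is mapped to <[frobv v]> (frob_sub_vline). *)
Definition frob_sub (U : {vspace 'rV[K]_3}) : {vspace 'rV[K]_3} :=
  <<map frobv (vbasis U)>>%VS.

Lemma frobv_eq0 v : frobv v = 0 -> v = 0.
Proof.
move=> /rowP v0; apply/rowP=> j; have := v0 j; rewrite !mxE => /eqP.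
by rewrite expf_eq0 => /andP[_ /eqP].
Qed.

Lemma frob_point_subproof (p : point K) : \dim (frob_sub p) == 1%N.
Proof.
rewrite /frob_sub; have d1 := eqP (point_dim p).
have sz : size (vbasis p) = 1%N by rewrite size_tuple.
have := @basis_not0 _ _ _ _ _ (vbasisP p); move: sz.
case: (tval _) => [|b [|? ?]] //= _ b0.
rewrite span_seq1 dim_vline; have: b != 0 by apply: b0; rewrite mem_head.
by case: (frobv b =P 0) => // /frobv_eq0->; rewrite eqxx.
Qed.

Definition frob_point (p : point K) : point K :=
  Point (frob_point_subproof p).

Definition is_q_point (p : point K) : Prop := frob_point p = p.

Definition is_q_line (l : line K) : Prop := frob_sub l = l.

Definition q_generic_point (p : point K) : Prop :=
  forall l : line K, is_q_line l -> ~~ on_line p l.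

Definition q_generic_line (l : line K) : Prop :=
  forall p : point K, is_q_point p -> ~~ on_line p l.

End Frobenius.

Section FrobeniusTheory.
Variables (K : fieldType) (q : nat).
Hypothesis qK : [pchar K].-nat q.

Lemma frobvD (u v : 'rV[K]_3) : frobv q (u + v) = frobv q u + frobv q v.
Proof. by apply/rowP=> j; rewrite !mxE exprDn_pchar. Qed.

Lemma frobv0 : frobv q (0 : 'rV[K]_3) = 0.
Proof.
apply/rowP=> j; rewrite !mxE expr0n; case: eqP => // q0.
by move: qK; rewrite q0.
Qed.

Lemma frobvZ a (v : 'rV[K]_3) : frobv q (a *: v) = a ^+ q *: frobv q v.
Proof. by apply/rowP=> j; rewrite !mxE exprMn. Qed.

Lemma frobv_sum n (a : 'I_n -> K) (v : 'I_n -> 'rV[K]_3) :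
  frobv q (\sum_i a i *: v i) = \sum_i a i ^+ q *: frobv q (v i).
Proof.
rewrite (big_morph _ frobvD frobv0).
by apply: eq_bigr => i _; rewrite frobvZ.
Qed.

Lemma mem_frob_sub (U : {vspace 'rV[K]_3}) u :
  u \in U -> frobv q u \in frob_sub q U.
Proof.
move=> /coord_vbasis->; rewrite frobv_sum.
apply: memv_suml => i _; apply/memvZ/memv_span/map_f/mem_nth.
by rewrite size_tuple.
Qed.

Lemma frob_sub_le (U W : {vspace 'rV[K]_3}) :
  (forall u, u \in U -> frobv q u \in W) -> (frob_sub q U <= W)%VS.
Proof.
by move=> UW; apply/span_subvP=> _ /mapP[b /vbasis_mem Ub ->]; apply: UW.
Qed.

Lemma frob_sub_vline (v : 'rV[K]_3) : frob_sub q <[v]>%VS = <[frobv q v]>%VS.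
Proof.
apply: subv_anti; rewrite -memvE mem_frob_sub ?memv_line // andbT.
apply: frob_sub_le => _ /vlineP[a ->].
by rewrite frobvZ memvZ ?memv_line.
Qed.

Lemma q_generic_neq_frob_pchar (p : point K) :
  q_generic_point q p -> p != frob_point q p.
Proof.
move=> gp; apply/eqP=> pE.
have dp := eqP (point_dim p).
have [v pv v0] : exists2 v, (v \in (p : {vspace _})) & v != 0.
  by exists (vpick p); rewrite ?memv_pick // vpick0 -dimv_eq0 dp.
have [i vi] : exists i, v 0 i != 0.
  apply/existsP; apply: contraNT v0; rewrite negb_exists => /forallP v0.
  by apply/eqP/rowP=> j; rewrite mxE; apply/eqP; rewrite -[_ == _]negbK v0.
have [w wv] : exists w, w = (v 0 i)^-1 *: v by exists ((v 0 i)^-1 *: v).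
have wi : w 0 i = 1 by rewrite wv mxE mulVf.
have w0 : w != 0 by apply: contra_eq_neq wi => ->; rewrite mxE eq_sym oner_neq0.
have pw : w \in (p : {vspace _}) by rewrite wv memvZ.
have pL : (p : {vspace _}) = <[w]>%VS.
  by apply/eqP; rewrite eq_sym eqEdim dp dim_vline w0 andbT -memvE.
have fw : frobv q w = w.
  have: frobv q w \in (p : {vspace _}) by rewrite pE /= mem_frob_sub.
  rewrite pL => /vlineP[c wc].
  have: frobv q w 0 i = c by rewrite wc mxE wi mulr1.
  by rewrite mxE wi expr1n => c1; rewrite wc -c1 scale1r.
pose e : 'rV[K]_3 := delta_mx 0 (lift i ord0).
have fe : frobv q e = e.
  apply/rowP=> j; rewrite !mxE; case: (_ && _); rewrite ?expr1n //.
  by rewrite expr0n; case: eqP => // q0; move: qK; rewrite q0.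
have e0 : e != 0.
  apply/eqP=> /rowP/(_ (lift i ord0)); rewrite !mxE !eqxx.
  by move/eqP; rewrite oner_eq0.
have de : \dim <[e]> == 1%N by rewrite dim_vline e0.
have ne : p != Point de.
  apply/eqP=> /(congr1 (@point_sub K)) /= pe; move: pw; rewrite pe.
  move=> /vlineP[c wc]; move: wi; rewrite wc !mxE (negPf (neq_lift _ _)).
  by rewrite andbF mulr0 => /eqP; rewrite eq_sym oner_eq0.
have := gp (line_through ne); rewrite /on_line /= addvSl => /(_ _)/negP.
apply=> //; apply: subv_anti; apply/andP; split.
  apply: frob_sub_le => u /memv_addP[x]; rewrite pL => /vlineP[a ->] [y].
  move=> /vlineP[b ->] ->; rewrite frobvD !frobvZ fw fe.
  by rewrite memv_add ?memvZ ?memv_line.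
rewrite subv_add {1}pL -!memvE; apply/andP; split.
  by rewrite -[X in X \in _]fw mem_frob_sub // (subvP (addvSl _ _)).
by rewrite -[X in X \in _]fe mem_frob_sub // (subvP (addvSr _ _)) ?memv_line.
Qed.

End FrobeniusTheory.

Lemma frob_subP (K : closedFieldType) (q : nat) (qK : [pchar K].-nat q)
    (U : {vspace 'rV[K]_3}) (w : 'rV[K]_3) :
  reflect (exists2 u, u \in U & w = frobv q u) (w \in frob_sub q U).
Proof.
apply: (iffP idP) => [|[u Uu ->]]; last exact: mem_frob_sub.
have q_gt0 : (0 < q)%N by case/andP: qK.
have rootK (x : K) : exists y, y ^+ q = x.
  have [y] := @solve_monicpoly K q (fun i => if i == 0%N then x else 0) q_gt0.
  rewrite -(prednK q_gt0) big_ord_recl /= mulr1 big1 ?addr0.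
    by move=> yE; exists y.
  by move=> i _; rewrite mul0r.
have bU : forall b, b \in tval (vbasis U) -> b \in U by move=> b /vbasis_mem.
rewrite /frob_sub span_def big_map; elim: (tval _) bU w => /=.
  move=> _ w; rewrite big_nil memv0 => /eqP->.
  by exists 0; rewrite ?mem0v // frobv0.
move=> b s IH Us w; rewrite big_cons => /memv_addP[_ /vlineP[a ->] [y sy ->]].
have [|u Uu ->] := IH _ y sy.
  by move=> z zs; apply: Us; rewrite inE zs orbT.
have [c <-] := rootK a.
exists (c *: b + u); last by rewrite frobvD // frobvZ.
by rewrite memvD // memvZ // Us // mem_head.
Qed.

Lemma pchar_nat_card (q : nat) (F : finFieldType) (K : fieldType)
    (iota : {rmorphism F -> K}) :
  (exists l k : nat, [/\ prime l, (0 < k)%N & q = (l ^ k)%N]) -> #|F| = q ->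
  [pchar K].-nat q.
Proof.
move=> [l [k [pl k0 ->]]] cF; have [/= p pp pF] := finPcharP F.
have := card_finPcharP cF pl => lF.
rewrite pnatX (eq_pnat _ (fmorph_pchar iota)) orbC.
by apply/orP; right; rewrite pnatE.
Qed.

Lemma q_generic_neq_frob (q : nat) (F : finFieldType) (K : fieldType)
    (iota : {rmorphism F -> K})
    (q_pp : exists l k : nat, [/\ prime l, (0 < k)%N & q = (l ^ k)%N])
    (card_F : #|F| = q) (p : point K) :
  q_generic_point q p -> p != frob_point q p.
Proof. exact: q_generic_neq_frob_pchar (pchar_nat_card iota q_pp card_F) p. Qed.

(* Main.v *)
Require Import Defs.
From mathcomp Require Import all_boot all_order all_algebra all_field.
Local Open Scope ring_scope.

(** If a q-point r lay on l = <p, f(p)>, then r would differ from p, hence also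
    from f(p), because f is injective and fixes r.  So l = <p, r> = <f(p), r>,
    whence f(l) = <f(p), f(r)> = <f(p), r> = l: a q-line through p. *)

Lemma frob_sub_leP {K : fieldType} {q : nat} (qK : [pchar K].-nat q)
    (U W : {vspace 'rV[K]_3}) :
  reflect (forall u, u \in U -> frobv q u \in W) (frob_sub q U <= W)%VS.
Proof.
apply: (iffP idP) => [/subvP sUW u Uu|]; last exact: frob_sub_le.
exact/sUW/mem_frob_sub.
Qed.

Lemma frob_subS {K : fieldType} {q : nat} (qK : [pchar K].-nat q)
    (U V : {vspace 'rV[K]_3}) :
  (U <= V)%VS -> (frob_sub q U <= frob_sub q V)%VS.
Proof.
by move=> /subvP sUV; apply/(frob_sub_leP qK) => u /sUV; apply: mem_frob_sub.
Qed.

Lemma frob_subD {K : fieldType} {q : nat} (qK : [pchar K].-nat q)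
    (U V : {vspace 'rV[K]_3}) :
  frob_sub q (U + V)%VS = (frob_sub q U + frob_sub q V)%VS.
Proof.
apply: subv_anti; rewrite subv_add !frob_subS ?addvSl ?addvSr // !andbT.
apply/(frob_sub_leP qK) => _ /memv_addP[u Uu [v Vv ->]].
by rewrite frobvD // memv_add ?mem_frob_sub.
Qed.

Lemma frobv_inj {K : fieldType} {q : nat} (qK : [pchar K].-nat q) :
  injective (@frobv K q).
Proof.
move=> u v fuv; apply/eqP; rewrite -GRing.subr_eq0; apply/eqP/(@frobv_eq0 K q).
apply: (@GRing.addIr _ (frobv q v)).
by rewrite -frobvD // GRing.subrK fuv GRing.add0r.
Qed.

Lemma frob_sub_inj {K : closedFieldType} {q : nat} (qK : [pchar K].-nat q) :
  injective (@frob_sub K q).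
Proof.
have le (U V : {vspace 'rV[K]_3}) : frob_sub q U = frob_sub q V -> (U <= V)%VS.
  move=> fUV; apply/subvP => u Uu; have := mem_frob_sub qK Uu.
  by rewrite fUV => /(frob_subP qK)[v Vv /(frobv_inj qK)->].
by move=> U V fUV; apply: subv_anti; rewrite !le.
Qed.

Lemma frob_point_inj {K : closedFieldType} {q : nat} (qK : [pchar K].-nat q) :
  injective (@frob_point K q).
Proof.
by move=> p r /(congr1 (@point_sub K)) /(frob_sub_inj qK) /val_inj.
Qed.

(* K is an algebraic closure of the field F with q elements. *)
Theorem lemma4p9 (q : nat)
    (q_pp : exists l k : nat, [/\ prime l, (0 < k)%N & q = (l ^ k)%N])
    (F : finFieldType) (card_F : #|F| = q)
    (K : closedFieldType) (iota : {rmorphism F -> K})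
    (K_alg : integralRange iota)
    (p : point K) (p_generic : q_generic_point q p) :
  q_generic_line q
    (line_through (q_generic_neq_frob iota q_pp card_F p_generic)).
Proof.
have qK := pchar_nat_card iota q_pp card_F.
have p_fp := q_generic_neq_frob iota q_pp card_F p_generic.
set l := line_through _ => r fr; apply/negP => rl.
have /andP[pl fpl] : on_line p l && on_line (frob_point q p) l.
  by rewrite /on_line addvSl addvSr.
have p_r : p != r by apply: contraNneq p_fp => ->; rewrite fr.
have fp_r : frob_point q p != r.
  by rewrite -{1}fr (inj_eq (frob_point_inj qK)).
have l_pr : l = line_through p_r by apply/eqP; rewrite -line_throughP pl.
have l_fpr : l = line_through fp_r by apply/eqP; rewrite -line_throughP fpl.
have fl : is_q_line q l.
  have fr_sub : frob_sub q r = r := congr1 (@point_sub K) fr.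
  by rewrite /is_q_line {1}l_pr l_fpr /= frob_subD // fr_sub.
by have := p_generic l fl; rewrite pl.
Qed.
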